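(* Let $\mathcal M=\{(A_1,B_1),\ldots,(A_M,B_M)\}\subset\mathbb R_+^{n\times n}\times\mathbb R^{n\times m}$, $E\in\mathbb R_+^{m\times n}$, $s\in\mathbb R^n_+$, $r\in\mathbb R^m$, $\gamma\in\mathbb R^n_+$ with $A_i\ge|B_i|E$ for all $i$ and $s\ge E^\top|r|$. Let $K_1,\ldots,K_M\in\mathcal K(E)\subset\mathbb R^{m\times n}$. Suppose there exist vectors $p_{ij}\in\mathbb R_+^n$, $i,j\in\{1,\ldots,M\}$, such that $0\le p_{ij}=p_{ji}\le\gamma$ and such that, for all $x\in\mathbb R_+^n$ and all $i,j,k\in\{1,\ldots,M\}$, excluding the case $i\ne j=k$, $$p_{jk}^\top x\ \ge\ s^\top x+r^\top K_kx+p_{ij}^\top\max\{A_ix+B_iK_kx,\ A_jx+B_jK_kx\}-\tfrac12\gamma^\top\bigl|(A_i-A_j)x+(B_i-B_j)K_kx\bigr|$$ (with componentwise maximum). Define $$V^{ij}(x,Z):=p_{ij}^\top x-\tfrac12\bigl(z^{(i)}+z^{(j)}\bigr),\qquad\overline V(x,Z):=\max_{i,j}V^{ij}(x,Z).$$ Then $\overline V$ solves the Bellman inequality, i.e. $\mathcal F\,\overline V(x,Z)\le\overline V(x,Z)$ holds. Consequently, the certainty equivalence control law $$u_t=K_{k_t}x_t,\qquad k_t=\arg\min_{i\in\{1,\ldots,M\}}z_t^{(i)}$$ satisfies the performance bound $J_\mu(x_0)\le\max_{i,j}p_{ij}^\top x_0$.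
   Context: Inequalities, maxima and absolute values of vectors and matrices are elementwise; $\mathbb R^n_+$ is the nonnegative orthant; $\mathbb N$ includes $0$. $\mathcal K(E):=\{K\in\mathbb R^{m\times n}:K=\Lambda E,\ \Lambda=\mathrm{diag}(\lambda_1,\dots,\lambda_m),\ \lambda_i\in[-1,1]\}$ and $\mathcal U(x):=\{u\in\mathbb R^m:|u|\le Ex\}$ for $x\in\mathbb R_+^n$. For a collection of real numbers $Z=\{z^{(1)},\ldots,z^{(M)}\}$ and a function $V(x,Z)$, the operator $\mathcal F$ is $$\mathcal FV(x,Z):=\min_{u\in\mathcal U(x)}\max_{v\ge0}\bigl\{s^\top x+r^\top u+V(v,Z_+)\bigr\},$$ where $v\in\mathbb R_+^n$, $Z_+=\{z_+^{(1)},\ldots,z_+^{(M)}\}$ and $z_+^{(i)}=z^{(i)}+\gamma^\top|v-A_ix-B_iu|$. The Bellman inequality is meant for all $x\in\mathbb R_+^n$ and all $Z$. Along a trajectory, the histories are $z_0^{(i)}=0$, $z_{t+1}^{(i)}=z_t^{(i)}+\gamma^\top|x_{t+1}-A_ix_t-B_iu_t|$, $i=1,\ldots,M$; they are computable from past states and inputs, so the control law above is causal. The cost of a causal policy $\mu$ (with $u_t=\mu_t(x_0,\dots,x_t;u_0,\dots,u_{t-1})\in\mathcal U(x_t)$) from $x_0\in\mathbb R_+^n$ is $$J_\mu(x_0)=\sup_{(A,B)\in\mathcal M,\ w,\ T\in\mathbb N}\ \sum_{t=0}^T\bigl(s^\top x_t+r^\top u_t-\gamma^\top|w_t|\bigr),$$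 subject to $x_{t+1}=Ax_t+Bu_t+w_t$, where the supremum is over disturbance sequences with $w_t\ge-(Ax_t+Bu_t)$ for all $t$. *)

(* Defs.v *)
From HB Require Import structures.
From mathcomp Require Import all_boot all_order all_algebra.
From mathcomp Require Import all_classical all_reals ereal.

Set Implicit Arguments.
Unset Strict Implicit.
Unset Printing Implicit Defensive.
Import Order.TTheory GRing.Theory Num.Theory.
Local Open Scope classical_set_scope.
Local Open Scope ring_scope.

(* Number of models: index sets {1, ..., M} with M >= 1 (needed for the maxima
   and the argmin to make sense) are rendered as 'I_N.+1, i.e. M = N + 1. *)

Section Elementwise.
Context {R : realType}.

Definition lemx a b (A B : 'M[R]_(a, b)) : Prop := forall i j, A i j <= B i j.

Definition absmx a b (A : 'M[R]_(a, b)) : 'M[R]_(a, b) := map_mx Num.norm A.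

Definition maxmx a b (A B : 'M[R]_(a, b)) : 'M[R]_(a, b) := map2_mx Num.max A B.

Definition dot n (p x : 'cV[R]_n) : R := (p^T *m x) 0 0.

End Elementwise.

Notation "A <=m B" := (lemx A B) (at level 70, no associativity).

Section Defs.
Context {R : realType}.

Definition is_max (S : set R) (y : R) : Prop := S y /\ ubound S y.
Definition is_min (S : set R) (y : R) : Prop := S y /\ lbound S y.

(* The seed [f ord0 ord0] is one of the terms, so this is max_{i,j} f i j. *)
Definition max2 N (f : 'I_N.+1 -> 'I_N.+1 -> R) : R :=
  \big[Num.max/f ord0 ord0]_i \big[Num.max/f ord0 ord0]_j f i j.

Definition argmin N (z : 'I_N.+1 -> R) (k : 'I_N.+1) : Prop :=
  forall i, z k <= z i.

Definition gains m n (E : 'M[R]_(m, n)) : set 'M[R]_(m, n) :=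
  [set K | exists2 lam : 'rV[R]_m,
     (forall i, -1 <= lam 0 i <= 1) & K = diag_mx lam *m E].

Definition inputs m n (E : 'M[R]_(m, n)) (x : 'cV[R]_n) : set 'cV[R]_m :=
  [set u | absmx u <=m E *m x].

Section Bellman.
Variables (n m N : nat).
Variables (A : 'I_N.+1 -> 'M[R]_n) (B : 'I_N.+1 -> 'M[R]_(n, m)).
Variables (E : 'M[R]_(m, n)) (s : 'cV[R]_n) (r : 'cV[R]_m) (gamma : 'cV[R]_n).

Definition zplus (Z : 'I_N.+1 -> R) (x : 'cV[R]_n) (u : 'cV[R]_m)
    (v : 'cV[R]_n) : 'I_N.+1 -> R :=
  fun i => Z i + dot gamma (absmx (v - A i *m x - B i *m u)).

(* [bellman_value V x Z y] says that y = (F V)(x, Z), i.e. that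
   y = min_{u in U(x)} Q u  with  Q u = max_{v >= 0} {s^T x + r^T u + V(v, Z_+)},
   all these extrema being attained.  F V is given by its graph because for
   a general V the extrema need not exist. *)
Definition bellman_value (V : 'cV[R]_n -> ('I_N.+1 -> R) -> R)
    (x : 'cV[R]_n) (Z : 'I_N.+1 -> R) (y : R) : Prop :=
  exists Q : 'cV[R]_m -> R,
    (forall u, inputs E x u ->
       is_max [set dot s x + dot r u + V v (zplus Z x u v) |
                 v in [set v | 0 <=m v]] (Q u)) /\
    is_min (Q @` inputs E x) y.

Definition bellman_inequality (V : 'cV[R]_n -> ('I_N.+1 -> R) -> R) : Prop :=
  forall (x : 'cV[R]_n) (Z : 'I_N.+1 -> R), 0 <=m x ->
    exists2 y, bellman_value V x Z y & y <= V x Z.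

End Bellman.

Definition Vij n N (p : 'I_N.+1 -> 'I_N.+1 -> 'cV[R]_n) (i j : 'I_N.+1)
    (x : 'cV[R]_n) (Z : 'I_N.+1 -> R) : R :=
  dot (p i j) x - 2^-1 * (Z i + Z j).

Definition Vbar n N (p : 'I_N.+1 -> 'I_N.+1 -> 'cV[R]_n)
    (x : 'cV[R]_n) (Z : 'I_N.+1 -> R) : R :=
  max2 (fun i j => Vij p i j x Z).

(* At time t a causal policy sees x_0, ..., x_t and u_0, ..., u_{t-1}. *)
Definition policy (n m : nat) : Type :=
  forall t : nat, ('I_t.+1 -> 'cV[R]_n) -> ('I_t -> 'cV[R]_m) -> 'cV[R]_m.

Definition respects_inputs n m (E : 'M[R]_(m, n)) (mu : policy n m) : Prop :=
  forall t (xs : 'I_t.+1 -> 'cV[R]_n) (us : 'I_t -> 'cV[R]_m),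
    (forall k, 0 <=m xs k) -> inputs E (xs ord_max) (mu t xs us).

Definition trajectory n m (mu : policy n m) (A : 'M[R]_n) (B : 'M[R]_(n, m))
    (x0 : 'cV[R]_n) (x : nat -> 'cV[R]_n) (u : nat -> 'cV[R]_m)
    (w : nat -> 'cV[R]_n) : Prop :=
  [/\ x 0%N = x0,
      forall t, u t = mu t (fun k : 'I_t.+1 => x k) (fun k : 'I_t => u k),
      forall t, x t.+1 = A *m x t + B *m u t + w t
    & forall t, - (A *m x t + B *m u t) <=m w t].

Definition cost n m (s : 'cV[R]_n) (r : 'cV[R]_m) (gamma : 'cV[R]_n)
    (models : set ('M[R]_n * 'M[R]_(n, m))) (mu : policy n m)
    (x0 : 'cV[R]_n) : \bar R :=
  ereal_sup [set J | exists AB x u w (T : nat),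
    [/\ models AB, trajectory mu AB.1 AB.2 x0 x u w
      & J = (\sum_(0 <= t < T.+1)
               (dot s (x t) + dot r (u t) - dot gamma (absmx (w t))))%:E]].

Section CertaintyEquivalence.
Variables (n m N : nat).
Variables (A : 'I_N.+1 -> 'M[R]_n) (B : 'I_N.+1 -> 'M[R]_(n, m)).
Variables (gamma : 'cV[R]_n).

(* z_t as a function of x_0, ..., x_t and u_0, ..., u_{t-1}. *)
Fixpoint history (t : nat) :
    ('I_t.+1 -> 'cV[R]_n) -> ('I_t -> 'cV[R]_m) -> 'I_N.+1 -> R :=
  match t with
  | 0%N => fun _ _ _ => 0
  | t'.+1 => fun xs us =>
      zplus A B gamma
        (history (fun k => xs (widen_ord (leqnSn t'.+1) k))
                 (fun k => us (widen_ord (leqnSn t') k)))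
        (xs (widen_ord (leqnSn t'.+1) ord_max)) (us ord_max) (xs ord_max)
  end.

(* A selection k_t of a minimizer of z_t; ties may be broken in any way,
   possibly depending on the available history. *)
Definition argmin_selection (kappa : forall t : nat,
    ('I_t.+1 -> 'cV[R]_n) -> ('I_t -> 'cV[R]_m) -> 'I_N.+1) : Prop :=
  forall t xs us, argmin (history xs us) (kappa t xs us).

Definition ce_policy (K : 'I_N.+1 -> 'M[R]_(m, n)) (kappa : forall t : nat,
    ('I_t.+1 -> 'cV[R]_n) -> ('I_t -> 'cV[R]_m) -> 'I_N.+1) : policy n m :=
  fun t xs us => K (kappa t xs us) *m xs ord_max.

End CertaintyEquivalence.

End Defs.

(* Main.v *)
Require Import Defs.
From mathcomp Require Import all_boot all_order all_algebra.
From mathcomp Require Import all_classical all_reals ereal.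
From mathcomp Require Import topology normedtype derive lra.
Set Implicit Arguments.
Unset Strict Implicit.
Unset Printing Implicit Defensive.
Import Order.TTheory GRing.Theory Num.Theory.
Import numFieldNormedType.Exports.
Local Open Scope classical_set_scope.
Local Open Scope ring_scope.

(** Fix [x], [Z], [u] and write [a_i = A_i x + B_i u] for the successor predicted
    by model [i]; it is nonnegative because [|u| <= E x] and [|B_i| E <= A_i].
    After a move to [v], the value [Vij] of a pair depends on [v] through
    [p_ij^T v - (gamma^T |v - a_i| + gamma^T |v - a_j|) / 2], which splits over
    coordinates.  Each coordinate is a concave piecewise linear function; since
    [0 <= p_ij <= gamma] it does not decrease before [max (a_i, a_j)] nor
    increase beyond it, so its peak is there ([scalar_peak], [pair_payoff_le],
    [pair_payoff_max]).  Hence the inner maximum of the Bellman operator is a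
    finite maximum [worst_value] over pairs ([worst_value_is_max]).  It is
    continuous in [u], so it has a minimum over the compact box of admissible
    inputs ([bellman_value_exists]).

    The Bellman inequality follows by playing [u = K_k x] for a minimizer [k] of
    [Z]: the hypothesis on [p] bounds the stage cost plus the peak of the pair
    [(i, j)] by [p_jk^T x], and [z_k <= z_i] gives [- z_i <= - z_k], so the bound is at most
    [V^{jk}(x, Z)].  In the excluded case [i <> j = k] the roles of [i] and [j] are
    exchanged, which changes nothing as pairs are symmetric
    ([certainty_equivalence_le]).

    This argument shows more than the Bellman inequality: the certainty
    equivalence input itself never lets stage cost plus next [Vbar] exceed the
    current [Vbar].  Summing along a trajectory bounds the total stage cost plus
    the final [Vbar] by the initial one ([Vbar_telescopes]).  If [l] is the model
    in force, [z^(l)] is exactly the accumulated disturbance penalty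
    ([history_true_model]), and the final [Vbar] is at least [V^{ll} >= - z^(l)];
    the two combine into the cost bound. *)

(** * Elementwise order and scalar products *)

Section Vectors.
Context {R : realType}.

Lemma le0mxP a b (x : 'M[R]_(a, b)) : 0 <=m x <-> forall i j, 0 <= x i j.
Proof. by split=> x0 i j; have := x0 i j; rewrite mxE. Qed.

Lemma dotE n (p x : 'cV[R]_n) : dot p x = \sum_i p i 0 * x i 0.
Proof. by rewrite /dot mxE; apply: eq_bigr => i _; rewrite mxE. Qed.

Lemma dot_ge0 n (p x : 'cV[R]_n) : 0 <=m p -> 0 <=m x -> 0 <= dot p x.
Proof.
move=> /le0mxP p0 /le0mxP x0; rewrite dotE.
by apply: sumr_ge0 => i _; apply: mulr_ge0.
Qed.

Lemma norm_mulmx_inputs_le m n (B : 'M[R]_(n, m)) (E : 'M[R]_(m, n))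
    (x : 'cV[R]_n) (u : 'cV[R]_m) i :
  inputs E x u -> `|(B *m u) i 0| <= (absmx B *m E *m x) i 0.
Proof.
move=> uEx; rewrite -mulmxA !mxE (le_trans (ler_norm_sum _ _ _))//.
apply: ler_sum => j _; rewrite normrM mxE ler_wpM2l//.
by have := uEx j 0; rewrite mxE.
Qed.

(** An admissible input moves the state by at most [absmx B *m E *m x] in each
    coordinate, and [A *m x] outweighs that. *)
Lemma positive_step m n (A : 'M[R]_n) (B : 'M[R]_(n, m)) (E : 'M[R]_(m, n))
    (x : 'cV[R]_n) (u : 'cV[R]_m) :
  absmx B *m E <=m A -> 0 <=m x -> inputs E x u -> 0 <=m A *m x + B *m u.
Proof.
move=> BE_A /le0mxP x0 uEx; apply/le0mxP => i j; rewrite (ord1 j) mxE.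
have Bu := norm_mulmx_inputs_le B i uEx.
have BEx : (absmx B *m E *m x) i 0 <= (A *m x) i 0.
  by rewrite ![(_ *m x) _ _]mxE; apply: ler_sum => k _; exact: ler_wpM2r.
have := ler_norm (- (B *m u) i 0); rewrite normrN; lra.
Qed.

Lemma gain_inputs m n (E K : 'M[R]_(m, n)) (x : 'cV[R]_n) :
  0 <=m E -> gains E K -> 0 <=m x -> inputs E x (K *m x).
Proof.
move=> /le0mxP E0 [lam lam1 ->] /le0mxP x0 i j; rewrite (ord1 j).
have Ex0 : 0 <= (E *m x) i 0.
  by rewrite mxE; apply: sumr_ge0 => k _; exact: mulr_ge0.
rewrite -mulmxA mul_diag_mx [leLHS]mxE [X in `|X|]mxE normrM (ger0_norm Ex0).
by rewrite ler_piMl ?ler_norml.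
Qed.

End Vectors.

(** * The inner maximization *)

Section Peak.
Context {R : realType}.

(** In [v] the left side has slope [p + g], [p] and [p - g] below, between and
    above [a] and [b]: the first two are nonnegative, the last is nonpositive. *)
Lemma scalar_peak (p g v a b : R) : 0 <= p -> p <= g ->
  p * v - 2^-1 * (g * `|v - a| + g * `|v - b|)
    <= p * Num.max a b - 2^-1 * (g * `|a - b|).
Proof.
move=> p0 pg; wlog ab : a b / a <= b.
  move=> H; have [ab|/ltW ba] := leP a b; first by have := H _ _ ab; rewrite max_r.
  by have := H _ _ ba; rewrite (distrC b a) (max_r ba); lra.
rewrite max_r// (distrC a b) (ger0_norm (_ : 0 <= b - a)) ?subr_ge0//.
have [vb|bv] := leP v b.
  have : 0 <= g * (`|v - a| + (b - v) - (b - a)).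
    by apply: mulr_ge0; [exact: le_trans pg|have := ler_norm (v - a); lra].
  have : 0 <= p * (b - v) by rewrite mulr_ge0// subr_ge0.
  rewrite (ler0_norm (_ : v - b <= 0)); lra.
rewrite !ger0_norm; [|lra..].
have : 0 <= (g - p) * (v - b) by rewrite mulr_ge0; lra.
lra.
Qed.

Lemma scalar_peak_attained (p g a b : R) :
  p * Num.max a b - 2^-1 * (g * `|Num.max a b - a| + g * `|Num.max a b - b|)
    = p * Num.max a b - 2^-1 * (g * `|a - b|).
Proof.
case: (leP a b) => ab; rewrite subrr normr0 mulr0 ?addr0 ?add0r//.
by rewrite distrC.
Qed.

(** The part of [Vij] after one step that depends on the successor [v], with [a]
    and [b] the successors predicted by the two models (see [Vij_zplus]). *)
Definition pair_payoff n (p g a b v : 'cV[R]_n) : R :=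
  dot p v - 2^-1 * (dot g (absmx (v - a)) + dot g (absmx (v - b))).

(** For [0 <= p <= g], the maximum of [pair_payoff] over [v], in the form in which
    it enters the inequality assumed on [p]. *)
Definition pair_peak n (p g a b : 'cV[R]_n) : R :=
  dot p (maxmx a b) - 2^-1 * dot g (absmx (a - b)).

Lemma pair_payoffE n (p g a b v : 'cV[R]_n) :
  pair_payoff p g a b v = \sum_i (p i 0 * v i 0
    - 2^-1 * (g i 0 * `|v i 0 - a i 0| + g i 0 * `|v i 0 - b i 0|)).
Proof.
rewrite /pair_payoff !dotE sumrB -mulr_sumr big_split.
by congr (_ - _ * (_ + _)); apply: eq_bigr => i _; rewrite !mxE.
Qed.

Lemma pair_peakE n (p g a b : 'cV[R]_n) :
  pair_peak p g a b = \sum_i (p i 0 * Num.max (a i 0) (b i 0)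
    - 2^-1 * (g i 0 * `|a i 0 - b i 0|)).
Proof.
rewrite /pair_peak !dotE sumrB -mulr_sumr.
by congr (_ - _ * _); apply: eq_bigr => i _; rewrite !mxE.
Qed.

Lemma pair_payoff_le n (p g a b v : 'cV[R]_n) :
  0 <=m p -> p <=m g -> pair_payoff p g a b v <= pair_peak p g a b.
Proof.
move=> /le0mxP p0 pg; rewrite pair_payoffE pair_peakE.
by apply: ler_sum => i _; exact: scalar_peak.
Qed.

Lemma pair_payoff_max n (p g a b : 'cV[R]_n) :
  pair_payoff p g a b (maxmx a b) = pair_peak p g a b.
Proof.
rewrite pair_payoffE pair_peakE; apply: eq_bigr => i _.
by rewrite mxE scalar_peak_attained.
Qed.

Lemma pair_peakC n (p g a b : 'cV[R]_n) :
  pair_peak p g a b = pair_peak p g b a.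
Proof.
rewrite !pair_peakE; apply: eq_bigr => i _.
by rewrite maxC distrC.
Qed.

End Peak.

Section Max2.
Context {R : realType} {N : nat}.
Implicit Types f g : 'I_N.+1 -> 'I_N.+1 -> R.

Lemma le_max2 f i j : f i j <= max2 f.
Proof. exact: bigmax_sup (le_bigmax _ _ j). Qed.

Lemma max2_le f y : (forall i j, f i j <= y) -> max2 f <= y.
Proof. by move=> fy; apply: bigmax_le => // i _; exact: bigmax_le. Qed.

Lemma max2_attained f : exists i j, max2 f = f i j.
Proof.
rewrite /max2; apply: (big_ind (fun y => exists i j, y = f i j)).
- by exists ord0, ord0.
- move=> _ _ [i [j ->]] [i' [j' ->]].
  by case: (leP (f i j) (f i' j')) => _; [exists i', j'|exists i, j].
move=> i _; apply: (big_ind (fun y => exists i j, y = f i j)).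
- by exists ord0, ord0.
- move=> _ _ [i1 [j1 ->]] [i2 [j2 ->]].
  by case: (leP (f i1 j1) (f i2 j2)) => _; [exists i2, j2|exists i1, j1].
by move=> j _; exists i, j.
Qed.

Lemma eq_max2 f g : (forall i j, f i j = g i j) -> max2 f = max2 g.
Proof.
move=> fg; rewrite /max2 fg; apply: eq_bigr => i _.
by apply: eq_bigr => j _; rewrite fg.
Qed.

End Max2.

(** * Continuity and the outer minimization *)

Section Continuity.
Context {R : realType} {T : topologicalType}.

(** The seed [f0] varies with [t] because the maxima in [max2] are seeded by one
    of their own terms; hence the induction on the index list. *)
Lemma bigmax_continuous (I : finType) (f0 : T -> R) (F : I -> T -> R) :
  continuous f0 -> (forall i, continuous (F i)) ->
  continuous (fun t => \big[Num.max/f0 t]_i F i t).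
Proof.
move=> f0C FC; elim: (index_enum I) => [|i r IH].
  by under eq_fun do rewrite big_nil.
under eq_fun do rewrite big_cons.
by move=> t; apply: (@continuous_max R T (F i)); [exact: FC|exact: IH].
Qed.

Lemma max2_continuous N (F : 'I_N.+1 -> 'I_N.+1 -> T -> R) :
  (forall i j, continuous (F i j)) ->
  continuous (fun t => max2 (fun i j => F i j t)).
Proof.
by move=> FC; apply: bigmax_continuous => // i; exact: bigmax_continuous.
Qed.

Lemma sum_continuous (I : finType) (F : I -> T -> R) :
  (forall i, continuous (F i)) -> continuous (fun t => \sum_i F i t).
Proof.
move=> FC t; apply: cvg_big => //; first exact: add_continuous.
by move=> i _; exact: FC.
Qed.

Lemma dot_continuous n (p : 'cV[R]_n) (F : T -> 'cV[R]_n) :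
  (forall i, continuous (fun t => F t i 0)) -> continuous (fun t => dot p (F t)).
Proof.
move=> FC; under eq_fun do rewrite dotE.
apply: sum_continuous => i t; apply: cvgM; [exact: cvg_cst|exact: FC].
Qed.

Lemma mulmx_continuous m n (B : 'M[R]_(n, m)) (F : T -> 'cV[R]_m) :
  (forall i, continuous (fun t => F t i 0)) ->
  forall i, continuous (fun t => (B *m F t) i 0).
Proof.
move=> FC i; under eq_fun do rewrite mxE.
apply: sum_continuous => j t; apply: cvgM; [exact: cvg_cst|exact: FC].
Qed.

Lemma pair_peak_continuous n (p g : 'cV[R]_n) (a b : T -> 'cV[R]_n) :
  (forall i, continuous (fun t => a t i 0)) ->
  (forall i, continuous (fun t => b t i 0)) ->
  continuous (fun t => pair_peak p g (a t) (b t)).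
Proof.
move=> aC bC; under eq_fun do rewrite pair_peakE.
apply: sum_continuous => i t; apply: cvgB.
  apply: cvgM; first exact: cvg_cst.
  by apply: (@continuous_max R T (fun t => a t i 0)); [exact: aC|exact: bC].
apply: cvgM; first exact: cvg_cst.
apply: cvgM; first exact: cvg_cst.
by apply: cvg_norm; apply: cvgB; [exact: aC|exact: bC].
Qed.

End Continuity.

(** The admissible inputs form a nonempty compact box, so the extreme value
    theorem applies; boxes are handled as sets of row vectors, whence the
    transposition. *)
Lemma inputs_argmin (R : realType) m n (E : 'M[R]_(m, n)) (x : 'cV[R]_n)
    (f : 'cV[R]_m -> R) :
  0 <=m E -> 0 <=m x -> continuous (fun u : 'rV[R]_m => f u^T) ->
  exists2 u, inputs E x u & forall v, inputs E x v -> f u <= f v.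
Proof.
move=> /le0mxP E0 /le0mxP x0 fC.
pose I i := [set` `[- (E *m x) i 0, (E *m x) i 0]] : set R.
pose box := [set u : 'rV[R]_m | forall i, I i (u ord0 i)].
have boxE u : box u^T <-> inputs E x u.
  split=> [H i j|H i].
    by have := H i; rewrite /I /= in_itv/= (ord1 j) !mxE -ler_norml.
  by have := H i 0; rewrite /I /= in_itv/= !mxE -ler_norml.
have cbox : compact box by apply: rV_compact => i; exact: segment_compact.
have box0 : box !=set0.
  exists 0^T; apply/boxE => i j; rewrite (ord1 j) !mxE normr0.
  by apply: sumr_ge0 => k _; exact: mulr_ge0.
have [u ubox umin] := compact_EVT_min box0 cbox (continuous_subspaceT fC).
exists u^T; first by apply/boxE; rewrite trmxK; exact: set_mem.
by move=> v /boxE vbox; rewrite -[v]trmxK; apply: umin; exact: mem_set.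
Qed.

(** * The Bellman operator applied to [Vbar] *)

Section Game.
Context {R : realType} {n m N : nat}.
Variables (A : 'I_N.+1 -> 'M[R]_n) (B : 'I_N.+1 -> 'M[R]_(n, m)).
Variables (E : 'M[R]_(m, n)) (s : 'cV[R]_n) (r : 'cV[R]_m) (gamma : 'cV[R]_n).
Variables (K : 'I_N.+1 -> 'M[R]_(m, n)) (p : 'I_N.+1 -> 'I_N.+1 -> 'cV[R]_n).
Hypotheses (E_ge0 : 0 <=m E) (A_ge : forall i, absmx (B i) *m E <=m A i).
Hypotheses (p_ge0 : forall i j, 0 <=m p i j) (p_le : forall i j, p i j <=m gamma).

Definition predict i (x : 'cV[R]_n) (u : 'cV[R]_m) : 'cV[R]_n :=
  A i *m x + B i *m u.

Definition Vij_peak i j (x : 'cV[R]_n) (u : 'cV[R]_m) (Z : 'I_N.+1 -> R) : R :=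
  pair_peak (p i j) gamma (predict i x u) (predict j x u)
    - 2^-1 * (Z i + Z j).

(** The inner maximum of the Bellman operator, in closed form; this identity is
    [worst_value_is_max]. *)
Definition worst_value (x : 'cV[R]_n) (Z : 'I_N.+1 -> R) (u : 'cV[R]_m) : R :=
  dot s x + dot r u + max2 (fun i j => Vij_peak i j x u Z).

Lemma Vij_zplus i j x u v Z :
  Vij p i j v (zplus A B gamma Z x u v)
    = pair_payoff (p i j) gamma (predict i x u) (predict j x u) v
      - 2^-1 * (Z i + Z j).
Proof.
by rewrite /Vij /zplus /pair_payoff /predict !opprD !addrA; lra.
Qed.

Lemma Vbar_zplus_le x u v Z :
  dot s x + dot r u + Vbar p v (zplus A B gamma Z x u v) <= worst_value x Z u.
Proof.
rewrite lerD2l; apply: max2_le => i j; apply: le_trans (le_max2 _ i j).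
by rewrite Vij_zplus lerD2r pair_payoff_le.
Qed.

(** The maxima over [v] and over pairs commute, so a pair attaining the maximum of
    the peaks yields the maximizing [v]: the larger of its two predictions, which
    is nonnegative like both of them. *)
Lemma worst_value_is_max x Z u : 0 <=m x -> inputs E x u ->
  is_max [set dot s x + dot r u + Vbar p v (zplus A B gamma Z x u v) |
            v in [set v | 0 <=m v]] (worst_value x Z u).
Proof.
move=> x0 uEx; split; last by move=> _ [v _ <-]; exact: Vbar_zplus_le.
have [i [j peakE]] := max2_attained (fun i j => Vij_peak i j x u Z).
exists (maxmx (predict i x u) (predict j x u)).
  apply/le0mxP => k l; rewrite mxE le_max; apply/orP; left.
  exact: (le0mxP _).1 (positive_step (A_ge i) x0 uEx) k l.
apply/eqP; rewrite eq_le Vbar_zplus_le/= /worst_value peakE lerD2l.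
apply: le_trans (le_max2 _ i j).
by rewrite Vij_zplus pair_payoff_max.
Qed.

Lemma worst_value_continuous (T : topologicalType) (F : T -> 'cV[R]_m) x Z :
  (forall i, continuous (fun t => F t i 0)) ->
  continuous (fun t => worst_value x Z (F t)).
Proof.
move=> FC.
have predC i k : continuous (fun t => predict i x (F t) k 0).
  under eq_fun do rewrite mxE.
  by move=> t; apply: cvgD; [exact: cvg_cst|exact: mulmx_continuous].
move=> t; apply: cvgD.
  by apply: cvgD; [exact: cvg_cst|exact: dot_continuous].
apply: (max2_continuous (F := fun i j t => Vij_peak i j x (F t) Z)) => i j t'.
apply: cvgB; last exact: cvg_cst.
exact: (pair_peak_continuous (predC i) (predC j)).
Qed.

Lemma bellman_value_exists x Z : 0 <=m x ->
  exists2 u, inputs E x u &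
    bellman_value A B E s r gamma (Vbar p) x Z (worst_value x Z u) /\
    forall v, inputs E x v -> worst_value x Z u <= worst_value x Z v.
Proof.
move=> x0.
have trC i : continuous (fun u : 'rV[R]_m => u^T i 0).
  by under eq_fun do rewrite mxE; exact: coord_continuous.
have [u uEx umin] :=
  inputs_argmin E_ge0 x0 (worst_value_continuous (x := x) (Z := Z) trC).
exists u => //; split => //; exists (worst_value x Z); split.
  by move=> v; exact: worst_value_is_max.
by split; [exists u|move=> _ [v vEx <-]; exact: umin].
Qed.

(** * Certainty equivalence *)

Hypothesis (p_sym : forall i j, p i j = p j i).
Hypothesis (p_ineq : forall x : 'cV[R]_n, 0 <=m x -> forall i j k : 'I_N.+1,
  ~ (i <> j /\ j = k) ->
  dot (p j k) x >=
    dot s x + dot r (K k *m x)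
    + dot (p i j) (maxmx (A i *m x + B i *m (K k *m x))
                         (A j *m x + B j *m (K k *m x)))
    - 2^-1 * dot gamma
               (absmx ((A i - A j) *m x + (B i - B j) *m (K k *m x)))).

Lemma p_ineq_peak x i j k : 0 <=m x -> ~ (i <> j /\ j = k) ->
  dot s x + dot r (K k *m x)
    + pair_peak (p i j) gamma (predict i x (K k *m x)) (predict j x (K k *m x))
  <= dot (p j k) x.
Proof.
move=> x0 /(p_ineq x0); rewrite /pair_peak /predict !mulmxBl opprD addrACA.
lra.
Qed.

(** For [k] a minimizer of [Z], replacing [Z i] by [Z k] only raises the bound
    [dot (p j k) x - 2^-1 * (Z i + Z j)] that the hypothesis on [p] provides. *)
Lemma certainty_equivalence_le x Z k : 0 <=m x -> argmin Z k ->
  worst_value x Z (K k *m x) <= Vbar p x Z.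
Proof.
move=> x0 kmin; rewrite /worst_value.
have [i [j ->]] := max2_attained (fun i j => Vij_peak i j x (K k *m x) Z).
rewrite /Vij_peak addrA.
have Vle l : dot (p l k) x - 2^-1 * (Z l + Z k) <= Vbar p x Z.
  exact: (le_max2 (fun i j => Vij p i j x Z) l k).
(* In the case excluded from the hypothesis, [(j, i, k)] is not excluded. *)
have [[ij jk]|nijk] := pselect (i <> j /\ j = k).
  rewrite pair_peakC p_sym.
  have /(p_ineq_peak x0) : ~ (j <> i /\ i = k).
    by move=> [_ ik]; apply: ij; rewrite ik.
  by have := Vle i; have := kmin j; lra.
by have := p_ineq_peak x0 nijk; have := Vle j; have := kmin i; lra.
Qed.

Hypothesis (K_gain : forall i, gains E (K i)).

Lemma bellman_inequality_Vbar : bellman_inequality A B E s r gamma (Vbar p).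
Proof.
move=> x Z x0; have [u uEx [uval umin]] := bellman_value_exists Z x0.
exists (worst_value x Z u) => //.
pose k := [arg min_(i < ord0) Z i]%O.
have kmin : argmin Z k by move=> i; rewrite /k; case: arg_minP => // j _; exact.
apply: le_trans (certainty_equivalence_le x0 kmin).
exact/umin/gain_inputs.
Qed.

(** * The performance bound *)

Section ClosedLoop.
Variable kappa : forall t : nat,
  ('I_t.+1 -> 'cV[R]_n) -> ('I_t -> 'cV[R]_m) -> 'I_N.+1.
Hypothesis kappa_argmin : argmin_selection A B gamma kappa.

Lemma ce_policy_inputs : respects_inputs E (ce_policy K kappa).
Proof. by move=> t xs us xs0; exact: gain_inputs. Qed.

Variables (l : 'I_N.+1) (x0 : 'cV[R]_n) (x : nat -> 'cV[R]_n).
Variables (u : nat -> 'cV[R]_m) (w : nat -> 'cV[R]_n).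
Hypothesis x0_ge0 : 0 <=m x0.
Hypothesis traj : trajectory (ce_policy K kappa) (A l) (B l) x0 x u w.

Let z t := history A B gamma (fun k : 'I_t.+1 => x k) (fun k : 'I_t => u k).

Lemma trajectory_ge0 t : 0 <=m x t.
Proof.
case: traj => x_0 _ xS w_ge; case: t => [|t]; first by rewrite x_0.
apply/le0mxP => i j; have := w_ge t i j; rewrite xS !mxE; lra.
Qed.

(** For the model in force, the prediction error is the disturbance itself. *)
Lemma history_true_model t :
  z t l = \sum_(0 <= k < t) dot gamma (absmx (w k)).
Proof.
case: traj => _ _ xS _; elim: t => [|t IH]; first by rewrite big_geq.
rewrite big_nat_recr//= -IH; congr (_ + dot _ (absmx _)).
by rewrite /= xS -addrA -opprD addrAC subrr add0r.
Qed.

(** One more stage is paid for by [certainty_equivalence_le], as the actual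
    successor [x t.+1] is among the [v] that [worst_value] maximizes over. *)
Lemma Vbar_telescopes t :
  \sum_(0 <= k < t) (dot s (x k) + dot r (u k)) + Vbar p (x t) (z t)
    <= Vbar p (x 0%N) (z 0%N).
Proof.
case: traj => _ uE _ _; elim: t => [|t IH]; first by rewrite big_geq// add0r.
apply: le_trans IH; rewrite big_nat_recr//= -addrA lerD2l.
have zS : z t.+1 = zplus A B gamma (z t) (x t) (u t) (x t.+1) by [].
pose k := kappa (fun k : 'I_t.+1 => x k) (fun k : 'I_t => u k).
have ut : u t = K k *m x t by exact: uE.
rewrite zS; apply: (le_trans (Vbar_zplus_le _ _ _ _)); rewrite ut.
by apply: certainty_equivalence_le; [exact: trajectory_ge0|exact: kappa_argmin].
Qed.

(** The final [Vbar] is at least the value of the diagonal pair of the model in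
    force, which is minus the accumulated penalty plus a nonnegative term. *)
Lemma trajectory_cost_le T :
  \sum_(0 <= t < T.+1) (dot s (x t) + dot r (u t) - dot gamma (absmx (w t)))
    <= max2 (fun i j => dot (p i j) x0).
Proof.
rewrite sumrB -history_true_model.
have V0 : Vbar p (x 0%N) (z 0%N) = max2 (fun i j => dot (p i j) x0).
  case: traj => -> _ _ _; apply: eq_max2 => i j.
  by rewrite /Vij /= addr0 mulr0 subr0.
rewrite -V0; apply: le_trans (Vbar_telescopes T.+1); rewrite lerD2l.
apply: le_trans (le_max2 _ l l); rewrite /Vij.
have := dot_ge0 (p_ge0 l l) (trajectory_ge0 T.+1); lra.
Qed.

End ClosedLoop.

End Game.

Theorem theorem3 (R : realType) (n m N : nat)
    (A : 'I_N.+1 -> 'M[R]_n) (B : 'I_N.+1 -> 'M[R]_(n, m))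
    (E : 'M[R]_(m, n)) (s : 'cV[R]_n) (r : 'cV[R]_m) (gamma : 'cV[R]_n)
    (K : 'I_N.+1 -> 'M[R]_(m, n))
    (p : 'I_N.+1 -> 'I_N.+1 -> 'cV[R]_n)
    (A_ge0 : forall i, 0 <=m A i) (E_ge0 : 0 <=m E)
    (s_ge0 : 0 <=m s) (gamma_ge0 : 0 <=m gamma)
    (A_ge : forall i, absmx (B i) *m E <=m A i)
    (s_ge : E^T *m absmx r <=m s)
    (K_gain : forall i, gains E (K i))
    (p_ge0 : forall i j, 0 <=m p i j)
    (p_sym : forall i j, p i j = p j i)
    (p_le : forall i j, p i j <=m gamma)
    (p_ineq : forall x : 'cV[R]_n, 0 <=m x -> forall i j k : 'I_N.+1,
       ~ (i <> j /\ j = k) ->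
       dot (p j k) x >=
         dot s x + dot r (K k *m x)
         + dot (p i j) (maxmx (A i *m x + B i *m (K k *m x))
                              (A j *m x + B j *m (K k *m x)))
         - 2^-1 * dot gamma
                    (absmx ((A i - A j) *m x + (B i - B j) *m (K k *m x)))) :
  bellman_inequality A B E s r gamma (Vbar p) /\
  (forall kappa : (forall t : nat,
       ('I_t.+1 -> 'cV[R]_n) -> ('I_t -> 'cV[R]_m) -> 'I_N.+1),
     argmin_selection A B gamma kappa ->
     respects_inputs E (ce_policy K kappa) /\
     forall x0 : 'cV[R]_n, 0 <=m x0 ->
       (cost s r gamma (range (fun i => (A i, B i))) (ce_policy K kappa) x0
        <= (max2 (fun i j => dot (p i j) x0))%:E)%E).
Proof.
split; first by apply: (bellman_inequality_Vbar (K := K)).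
move=> kappa kappa_argmin; split; first exact: ce_policy_inputs.
move=> x0 x0_ge0; apply: ge_ereal_sup => _ [AB [x [u [w [T [[l _ <-] traj ->]]]]]].
rewrite lee_fin; exact: trajectory_cost_le traj T.
Qed.
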